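(* For every positive infinitesimal real $\varepsilon$, there exists an integer $Q$, depending only on $\varepsilon$, such that for every standard $x\in\mathbb{R}$ there exists $P_x\in\mathbb{Z}$ such that $$x=\frac{P_x}{Q}+\varepsilon\phi\quad\text{and}\quad \varepsilon Q\cong 0,$$ where $\phi$ denotes an infinitesimal real number (which may depend on $x$).
   Context: The framework is nonstandard analysis in Nelson's Internal Set Theory (IST), with the predicate ''standard'' and the principles of idealization (I), standardization (S) and transfer (T). A real $y$ is infinitesimal, written $y\cong 0$, if $|y|<r$ for every standard real $r>0$. Here $\mathbb{R}$ and $\mathbb{Z}$ are the usual (internal) sets of IST, containing standard and nonstandard elements. The symbol $\phi$ stands for some infinitesimal real about which nothing else is asserted. $Q$, being a denominator, is nonzero. *)

(* Defs.v *)
From HB Require Import structures.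
From mathcomp Require Import all_boot all_order all_algebra.

Set Implicit Arguments.
Unset Strict Implicit.
Unset Printing Implicit Defensive.

Import Order.TTheory GRing.Theory Num.Theory.
Local Open Scope ring_scope.

(* A theorem of IST is stated here as a statement about an arbitrary model of
   IST: the universe of sets [V] may be ill-founded seen from Rocq, and Rocq
   predicates on [V] need not be internal.  The schemas of ZFC and of IST
   therefore range over first-order formulas, in de Bruijn notation, and not
   over Rocq predicates. *)

Inductive formula : Type :=
  | Mem of nat & nat
  | Equal of nat & nat
  | Standard of nat
  | Neg of formula
  | And of formula & formula
  | All of formula.

Fixpoint internal (f : formula) : bool :=
  match f with
  | Mem _ _ | Equal _ _ => true
  | Standard _ => false
  | Neg g => internal g
  | And g h => internal g && internal h
  | All g => internal g
  end.

Fixpoint free (n : nat) (f : formula) : bool :=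
  match f with
  | Mem i j | Equal i j => (n == i) || (n == j)
  | Standard i => n == i
  | Neg g => free n g
  | And g h => free n g || free n h
  | All g => free n.+1 g
  end.

Definition scons (V : Type) (x : V) (e : nat -> V) : nat -> V :=
  fun n => if n is m.+1 then e m else x.

Section SetTheory.

Variables (V : Type) (mem : V -> V -> Prop) (st : V -> Prop).

Local Notation "x ∈ y" := (mem x y) (at level 70).

Fixpoint sat (e : nat -> V) (f : formula) : Prop :=
  match f with
  | Mem i j => e i ∈ e j
  | Equal i j => e i = e j
  | Standard i => st (e i)
  | Neg g => ~ sat e g
  | And g h => sat e g /\ sat e h
  | All g => forall x : V, sat (scons x e) g
  end.

Definition is_empty (x : V) : Prop := forall z, ~ z ∈ x.

Definition subset (x y : V) : Prop := forall z, z ∈ x -> z ∈ y.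

(* t = s ∪ {x} *)
Definition is_adjunction (t s x : V) : Prop :=
  forall z, z ∈ t <-> z ∈ s \/ z = x.

Definition is_upair (p x y : V) : Prop := forall z, z ∈ p <-> z = x \/ z = y.

(* Kuratowski pairs: p = {{x}, {x, y}} *)
Definition is_pair (p x y : V) : Prop :=
  exists a b, [/\ is_upair a x x, is_upair b x y & is_upair p a b].

(* Finiteness in the sense of the model: z belongs to every family of sets that
   contains the empty set and is closed under adjoining an element of z. *)
Definition finite (z : V) : Prop :=
  forall K : V,
    (forall s, is_empty s -> s ∈ K) ->
    (forall s t x, s ∈ K -> x ∈ z -> is_adjunction t s x -> t ∈ K) ->
    z ∈ K.

Record ZFC : Prop := {
  extensionality : forall x y, (forall z, z ∈ x <-> z ∈ y) -> x = y;
  foundation : forall x, (exists y, y ∈ x) ->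
    exists y, y ∈ x /\ forall z, z ∈ x -> ~ z ∈ y;
  pairing : forall x y, exists p, is_upair p x y;
  union : forall x, exists u, forall z, z ∈ u <-> exists y, y ∈ x /\ z ∈ y;
  powerset : forall x, exists p, forall z, z ∈ p <-> subset z x;
  infinity : exists w, (exists x, is_empty x /\ x ∈ w) /\
    forall x, x ∈ w -> exists y, is_adjunction y x x /\ y ∈ w;
  separation : forall f, internal f -> forall (e : nat -> V) a,
    exists b, forall x, x ∈ b <-> x ∈ a /\ sat (scons x e) f;
  replacement : forall f, internal f -> forall (e : nat -> V) a,
    (forall x, x ∈ a -> exists! y, sat (scons x (scons y e)) f) ->
    exists b, forall y, y ∈ b <->
      exists x, x ∈ a /\ sat (scons x (scons y e)) f;
  choice : forall a,
    (forall x, x ∈ a -> exists y, y ∈ x) ->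
    (forall x y, x ∈ a -> y ∈ a -> x <> y -> forall z, ~ (z ∈ x /\ z ∈ y)) ->
    exists c, forall x, x ∈ a -> exists! y, y ∈ c /\ y ∈ x
}.

(* Only the parameters that occur in the formula have to be standard. *)
Definition transfer : Prop :=
  forall f, internal f -> forall e : nat -> V,
    (forall n, free n.+1 f -> st (e n)) ->
    (forall x, st x -> sat (scons x e) f) -> forall x, sat (scons x e) f.

(* The parameters are arbitrary, standard or not. *)
Definition idealization : Prop :=
  forall f, internal f -> forall e : nat -> V,
    (forall z, st z -> finite z ->
       exists x, forall y, y ∈ z -> sat (scons x (scons y e)) f) <->
    (exists x, forall y, st y -> sat (scons x (scons y e)) f).

(* The formula may be external, and the parameters are arbitrary. *)
Definition standardization : Prop :=
  forall (f : formula) (e : nat -> V) a, st a ->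
    exists b, st b /\
      forall z, st z -> (z ∈ b <-> z ∈ a /\ sat (scons z e) f).

End SetTheory.

Record istModel : Type := IstModel {
  universe :> Type;
  mem : universe -> universe -> Prop;
  st : universe -> Prop;
  ist_zfc : ZFC mem st;
  ist_idealization : idealization mem st;
  ist_standardization : standardization mem st;
  ist_transfer : transfer mem st
}.

(* The real numbers of a model: a standard complete ordered field, that is, a
   standard set with standard operations and order (given by their graphs).
   Every construction of the reals in ZFC gives one.  Its elements, with the
   operations of the model, form an ordered field in Rocq, here a
   [realFieldType] with the bijection [code] onto the elements of the set.
   Completeness is that of the model: it concerns sets of the model only, so
   the field need not be archimedean seen from Rocq, and may have
   infinitesimals. *)
Record reals (M : istModel) : Type := Reals {
  real_field :> realFieldType;
  code : real_field -> M;
  code_inj : injective code;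
  real_set : exists A : M, st A /\
    forall v, mem v A <-> exists x, v = code x;
  real_add : exists A : M, st A /\
    forall v, mem v A <-> exists x y p,
      is_pair (@mem M) p (code x) (code y) /\
      is_pair (@mem M) v p (code (x + y));
  real_mul : exists A : M, st A /\
    forall v, mem v A <-> exists x y p,
      is_pair (@mem M) p (code x) (code y) /\
      is_pair (@mem M) v p (code (x * y));
  real_le : exists A : M, st A /\
    forall v, mem v A <-> exists x y,
      x <= y /\ is_pair (@mem M) v (code x) (code y);
  real_complete : forall S : M,
    (exists x, mem (code x) S) ->
    (exists b, forall x, mem (code x) S -> x <= b) ->
    exists s, (forall x, mem (code x) S -> x <= s) /\
      forall b, (forall x, mem (code x) S -> x <= b) -> s <= b
}.

Section Reals.

Variables (M : istModel) (R : reals M).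

Definition standard (x : R) : Prop := st (code x).

Definition infinitesimal (y : R) : Prop :=
  forall r : R, standard r -> 0 < r -> `|y| < r.

(* Membership in the ring of integers of the model: S ranges over the sets of
   the model, so nonstandard integers are included. *)
Definition is_integer (x : R) : Prop :=
  forall S : M, mem (code (0 : R)) S ->
    (forall y : R, mem (code y) S ->
       mem (code (y + 1)) S /\ mem (code (y - 1)) S) ->
    mem (code x) S.

End Reals.

(* Main.v *)
Require Import Defs.
From HB Require Import structures.
From mathcomp Require Import all_boot all_order all_algebra.
From mathcomp Require Import ring lra.
From Stdlib Require Import Classical.

(** The whole difficulty is to find one nonzero integer [Q] such that, for every
    standard [y], [Q * y] is within [(eps * Q) ^ 2] of an integer, while
    [eps * Q] is smaller than every standard positive [y].  Then [eps * Q] is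
    infinitesimal and [phi := (x - P / Q) / eps] satisfies
    [`|phi| < eps * Q].  The square is what lets a condition on a single real
    [y] control two things at once, the quality of the approximation and the
    size of [eps * Q]; idealization then applies to one variable, and reduces
    the problem to a standard finite set [z] of values of [y].

    For a finite [z] the statement is asymptotic in [eps] and internal
    ([finite_approximation]): there is [h > 0] such that a suitable [Q] exists
    for every positive [eps < h].  By transfer [h] can be taken standard, so
    that the given infinitesimal is below it.

    Dirichlet's theorem does not prove [finite_approximation]: it gives some
    [Q] in a long range, perhaps a very small one, and multiples of that [Q] do
    not improve the fraction.  What is needed is a [Q] in a prescribed window,
    with [r / 2 < eps * Q < r] where [r] is a lower bound for the positive
    elements of [z], and with [Q * y] within the fixed distance [r ^ 2 / 4] of
    an integer.  It exists because the map [Q |-> (Q * y mod 1)_(y in z)] has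
    totally bounded image ([finite_totally_bounded]): every integer [N] has the
    same image, up to a given error, as some [q] bounded independently of [N],
    and then [Q := N - q] is a simultaneous near-period at bounded distance
    from [N].  Take for [N] an integer slightly beyond the lower end of the
    window, whose length is of order [1 / eps].

    Finiteness, induction on the integers and the existence of integer parts
    are those of the model, so each induction must be over a predicate given by
    an internal formula.  Formulas are handled through definability: closure
    lemmas make the internality of a Rocq predicate a syntax-directed check. *)

Set Implicit Arguments.
Unset Strict Implicit.
Unset Printing Implicit Defensive.

(* The names of set theory take precedence over [mem] and [Mem] of predicates. *)
Import Defs.
Import Order.TTheory GRing.Theory Num.Theory.
Local Open Scope ring_scope.

(** * Renaming variables of formulas *)

Fixpoint rename (s : nat -> nat) (f : formula) : formula :=
  match f with
  | Mem i j => Mem (s i) (s j)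
  | Equal i j => Equal (s i) (s j)
  | Standard i => Standard (s i)
  | Neg g => Neg (rename s g)
  | And g h => And (rename s g) (rename s h)
  | All g => All (rename (scons 0 (fun n => (s n).+1)) g)
  end%N.

Lemma internal_rename s f : internal (rename s f) = internal f.
Proof.
by elim: f s => //= f IHf g IHg s; rewrite IHf IHg.
Qed.

Lemma sat_rename (V : Type) (mem : V -> V -> Prop) (st : V -> Prop) f s e e' :
  (forall n, e (s n) = e' n) ->
  sat mem st e (rename s f) <-> sat mem st e' f.
Proof.
elim: f s e e' => [i j|i j|i|f IHf|f IHf g IHg|f IHf] s e e' ee' /=;
  rewrite ?ee' //.
- by rewrite (IHf _ _ _ ee').
- by rewrite (IHf _ _ _ ee') (IHg _ _ _ ee').
- have ee'x x n : scons x e (scons 0%N (fun n => (s n).+1) n) = scons x e' n.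
    by case: n.
  by split=> sf x; apply/(IHf _ _ _ (ee'x x)).
Qed.

(** * Kuratowski pairs *)

Section Pairs.

Variable M : istModel.
Implicit Types a b p x y : M.

Lemma upair_mem p x y : is_upair (@mem M) p x y -> mem x p /\ mem y p.
Proof. by move=> H; split; apply/H; [left | right]. Qed.

Lemma upair_inj p x y x' y' :
  is_upair (@mem M) p x y -> is_upair (@mem M) p x' y' ->
  (x = x' /\ y = y') \/ (x = y' /\ y = x').
Proof.
move=> H H'; have [xp yp] := upair_mem H; have [xp' yp'] := upair_mem H'.
move/H': xp => xp; move/H': yp => yp; move/H: xp' => xp'; move/H: yp' => yp'.
by intuition congruence.
Qed.

Lemma upair_ex x y : exists p, is_upair (@mem M) p x y.
Proof. exact: (pairing (ist_zfc M)). Qed.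

Lemma pair_ex x y : exists p, is_pair (@mem M) p x y.
Proof.
have [a Ha] := upair_ex x x; have [b Hb] := upair_ex x y.
by have [p Hp] := upair_ex a b; exists p, a, b.
Qed.

Lemma pair_inj p x y x' y' :
  is_pair (@mem M) p x y -> is_pair (@mem M) p x' y' -> x = x' /\ y = y'.
Proof.
move=> [a [b [Ha Hb Hp]]] [a' [b' [Ha' Hb' Hp']]].
have [[ea eb]|[ea eb]] := upair_inj Hp Hp'; subst a' b'.
  have [[ex _]|[ex _]] := upair_inj Ha Ha'; subst x';
  by have [[_ ey]|[ex ey]] := upair_inj Hb Hb'; split => //; congruence.
have [[e1 e2]|[e1 e2]] := upair_inj Ha Hb';
have [[e3 e4]|[e3 e4]] := upair_inj Hb Ha'; split; congruence.
Qed.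

End Pairs.

(** * Definable predicates *)

(** The interpretation of the arithmetic by standard sets of the model, with the
    witnesses fixed once and for all so that formulas can refer to them. *)
Record arithmetic (M : istModel) (R : reals M) := Arithmetic {
  carrier : M;
  sum_graph : M;
  product_graph : M;
  order_graph : M;
  st_carrier : st carrier;
  st_sum_graph : st sum_graph;
  st_product_graph : st product_graph;
  st_order_graph : st order_graph;
  carrierP : forall v, mem v carrier <-> exists x : R, v = code x;
  sum_graphP : forall v, mem v sum_graph <-> exists (x y : R) p,
    is_pair (@mem M) p (code x) (code y) /\
    is_pair (@mem M) v p (code (x + y));
  product_graphP : forall v, mem v product_graph <-> exists (x y : R) p,
    is_pair (@mem M) p (code x) (code y) /\
    is_pair (@mem M) v p (code (x * y));
  order_graphP : forall v, mem v order_graph <-> exists x y : R,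
    x <= y /\ is_pair (@mem M) v (code x) (code y)
}.

Lemma arithmetic_ex (M : istModel) (R : reals M) : inhabited (arithmetic R).
Proof.
have [A [sA HA]] := real_set R; have [P [sP HP]] := real_add R.
have [T [sT HT]] := real_mul R; have [L [sL HL]] := real_le R.
by exists; exists A P T L.
Qed.

Section Definability.

Variables (M : istModel) (R : reals M) (ar : arithmetic R).

Implicit Types (e : nat -> M).

Definition is_variable (C : Type) (env : C -> nat -> M) (u : C -> M) : Prop :=
  exists n, forall c, env c n = u c.

(** A context is a type of assignments: the values of the variables in scope,
    some of them sets of the model and some of them reals.  Real variables are
    seen by formulas through their codes, and the arithmetic is always in
    scope. *)
Record context := MakeContext {
  assignment :> Type;
  env : assignment -> nat -> M;
  carrier_variable : is_variable env (fun=> carrier ar);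
  sum_variable : is_variable env (fun=> sum_graph ar);
  product_variable : is_variable env (fun=> product_graph ar);
  order_variable : is_variable env (fun=> order_graph ar)
}.

Lemma is_variable_shift (C D : Type) (env : C -> nat -> M) (k : D -> C)
    (x : D -> M) u :
  is_variable env u ->
  is_variable (fun d => scons (x d) (env (k d))) (fun d => u (k d)).
Proof. by move=> [n Hn]; exists n.+1 => d /=. Qed.

Lemma is_variable_at (C : Type) (env : C -> nat -> M) u n :
  (forall c, env c n = u c) -> is_variable env u.
Proof. by exists n. Qed.

Definition parameters e : context :=
  @MakeContext unit
    (fun _ => scons (carrier ar) (scons (sum_graph ar)
       (scons (product_graph ar) (scons (order_graph ar) e))))
    (is_variable_at (n := 0) (fun=> erefl))
    (is_variable_at (n := 1) (fun=> erefl))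
    (is_variable_at (n := 2) (fun=> erefl))
    (is_variable_at (n := 3) (fun=> erefl)).

(** The environment is completed by a standard set, so that transfer applies
    whenever [v] is standard. *)
Definition parameters1 (v : M) : nat -> M := scons v (fun=> carrier ar).

Definition extend_set (C : context) : context :=
  @MakeContext (C * M) (fun c => scons c.2 (env c.1))
    (is_variable_shift _ _ (carrier_variable C))
    (is_variable_shift _ _ (sum_variable C))
    (is_variable_shift _ _ (product_variable C))
    (is_variable_shift _ _ (order_variable C)).

Definition extend_real (C : context) : context :=
  @MakeContext (C * R) (fun c => scons (code c.2) (env c.1))
    (is_variable_shift _ _ (carrier_variable C))
    (is_variable_shift _ _ (sum_variable C))
    (is_variable_shift _ _ (product_variable C))
    (is_variable_shift _ _ (order_variable C)).

Lemma is_variable_set (C : context) u : is_variable (@env C) u ->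
  is_variable (@env (extend_set C)) (fun c => u c.1).
Proof. exact: is_variable_shift. Qed.

Lemma is_variable_real (C : context) u : is_variable (@env C) u ->
  is_variable (@env (extend_real C)) (fun c => u c.1).
Proof. exact: is_variable_shift. Qed.

(** The formula may not depend on the assignment.  This is what makes [P]
    internal, and it is not automatic for a Rocq predicate. *)
Definition definable (C : context) (P : C -> Prop) : Prop :=
  exists2 f, internal f & forall c, P c <-> sat (@mem M) (@st M) (env c) f.

(** A term is definable through its graph, since formulas have no function
    symbols. *)
Definition definable_term (C : context) (t : C -> R) : Prop :=
  @definable (extend_real C) (fun c => c.2 = t c.1).

Implicit Types C D : context.

Lemma definable_iff C (P Q : C -> Prop) :
  (forall c, P c <-> Q c) -> definable P -> definable Q.
Proof. by move=> PQ [f If Hf]; exists f => // c; rewrite -PQ. Qed.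

Lemma definable_rename C D (k : D -> C) (s : nat -> nat) (P : C -> Prop) :
  (forall d n, env d (s n) = env (k d) n) ->
  definable P -> definable (fun d => P (k d)).
Proof.
move=> Hs [f If Hf]; exists (rename s f); first by rewrite internal_rename.
by move=> d; rewrite Hf; apply: iff_sym; apply: sat_rename.
Qed.

Lemma definable_mem C (u v : C -> M) :
  is_variable (@env C) u -> is_variable (@env C) v ->
  definable (fun c => mem (u c) (v c)).
Proof. by move=> [i Hi] [j Hj]; exists (Mem i j) => // c /=; rewrite Hi Hj. Qed.

Lemma definable_eq C (u v : C -> M) :
  is_variable (@env C) u -> is_variable (@env C) v ->
  definable (fun c => u c = v c).
Proof.
by move=> [i Hi] [j Hj]; exists (Equal i j) => // c /=; rewrite Hi Hj.
Qed.

Lemma definable_not C (P : C -> Prop) :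
  definable P -> definable (fun c => ~ P c).
Proof. by move=> [f If Hf]; exists (Neg f) => // c /=; rewrite Hf. Qed.

Lemma definable_and C (P Q : C -> Prop) :
  definable P -> definable Q -> definable (fun c => P c /\ Q c).
Proof.
move=> [f If Hf] [g Ig Hg]; exists (And f g); first by rewrite /= If Ig.
by move=> c /=; rewrite Hf Hg.
Qed.

(** The primitive connectives are negation, conjunction and universal
    quantification, so the other ones are definable only up to classical
    equivalence. *)
Lemma definable_or C (P Q : C -> Prop) :
  definable P -> definable Q -> definable (fun c => P c \/ Q c).
Proof.
move=> dP dQ; apply: (@definable_iff C (fun c => ~ (~ P c /\ ~ Q c))).
  by move=> c; case: (classic (P c)); case: (classic (Q c)); tauto.
by apply/definable_not/definable_and; apply: definable_not.
Qed.

Lemma definable_imp C (P Q : C -> Prop) :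
  definable P -> definable Q -> definable (fun c => P c -> Q c).
Proof.
move=> dP dQ; apply: (@definable_iff C (fun c => ~ P c \/ Q c)).
  by move=> c; case: (classic (P c)); tauto.
by apply: definable_or => //; apply: definable_not.
Qed.

Lemma definable_equiv C (P Q : C -> Prop) :
  definable P -> definable Q -> definable (fun c => P c <-> Q c).
Proof. by move=> dP dQ; apply: definable_and; apply: definable_imp. Qed.

Lemma definable_all_set C (P : C -> M -> Prop) :
  @definable (extend_set C) (fun c => P c.1 c.2) ->
  definable (fun c => forall x, P c x).
Proof.
move=> [f If Hf]; exists (All f) => // c /=.
by split=> H x; apply/(Hf (c, x)); apply: H.
Qed.

Lemma definable_ex_set C (P : C -> M -> Prop) :
  @definable (extend_set C) (fun c => P c.1 c.2) ->
  definable (fun c => exists x, P c x).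
Proof.
move=> dP; apply: (@definable_iff C (fun c => ~ forall x, ~ P c x)).
  move=> c; split; first by move/not_all_ex_not=> [x /NNPP]; exists x.
  by move=> [x Px] /(_ x).
exact/definable_not/definable_all_set/definable_not.
Qed.

(** Quantification over the reals is quantification over the carrier. *)
Lemma definable_all_real C (P : C -> R -> Prop) :
  @definable (extend_real C) (fun c => P c.1 c.2) ->
  definable (fun c => forall x, P c x).
Proof.
move=> [f If Hf]; have [i Hi] := carrier_variable C.
exists (All (Neg (And (Mem 0 i.+1) (Neg f)))) => // c /=; rewrite Hi; split.
  by move=> H v [/carrierP [x ->]]; apply; apply/(Hf (c, x)); apply: H.
move=> H x; apply/(Hf (c, x)); apply: NNPP => nf; apply: (H (code x)).
by split=> //; apply/carrierP; exists x.
Qed.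

Lemma definable_ex_real C (P : C -> R -> Prop) :
  @definable (extend_real C) (fun c => P c.1 c.2) ->
  definable (fun c => exists x, P c x).
Proof.
move=> dP; apply: (@definable_iff C (fun c => ~ forall x, ~ P c x)).
  move=> c; split; first by move/not_all_ex_not=> [x /NNPP]; exists x.
  by move=> [x Px] /(_ x).
exact/definable_not/definable_all_real/definable_not.
Qed.

Lemma definable_upair C (p x y : C -> M) :
  is_variable (@env C) p -> is_variable (@env C) x ->
  is_variable (@env C) y ->
  definable (fun c => is_upair (@mem M) (p c) (x c) (y c)).
Proof.
move=> /is_variable_set vp /is_variable_set vx /is_variable_set vy.
apply: definable_all_set.
have v0 : is_variable (@env (extend_set C)) (fun c => c.2) by exists 0%N.
apply: definable_equiv; first exact: definable_mem.
by apply: definable_or; apply: definable_eq.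
Qed.

Lemma definable_pair C (p x y : C -> M) :
  is_variable (@env C) p -> is_variable (@env C) x ->
  is_variable (@env C) y ->
  definable (fun c => is_pair (@mem M) (p c) (x c) (y c)).
Proof.
move=> /is_variable_set/is_variable_set vp /is_variable_set/is_variable_set vx.
move=> /is_variable_set/is_variable_set vy.
do 2!apply: definable_ex_set.
have v0 : is_variable (@env (extend_set (extend_set C))) (fun c => c.2).
  by exists 0%N.
have v1 : is_variable (@env (extend_set (extend_set C))) (fun c => c.1.2).
  by exists 1%N.
apply: (@definable_iff _ (fun c : extend_set (extend_set C) =>
   is_upair (@mem M) c.1.2 (x c.1.1) (x c.1.1) /\
   (is_upair (@mem M) c.2 (x c.1.1) (y c.1.1) /\
    is_upair (@mem M) (p c.1.1) c.1.2 c.2))).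
  by move=> c; split=> [[? [? ?]]|[? ? ?]].
by do !apply: definable_and; apply: definable_upair.
Qed.

(** Terms are eliminated in favour of variables: [P c (t c)] means that some [x]
    equal to [t c] satisfies [P c]. *)
Lemma definable_subst C (P : C -> R -> Prop) (t : C -> R) :
  definable_term t -> @definable (extend_real C) (fun c => P c.1 c.2) ->
  definable (fun c => P c (t c)).
Proof.
move=> dt dP; apply: (@definable_iff C (fun c => exists x, x = t c /\ P c x)).
  by move=> c; split=> [[x [-> //]]|Pt]; exists (t c).
by apply: definable_ex_real; apply: definable_and.
Qed.

Lemma definable_term_variable C (t : C -> R) :
  is_variable (@env C) (fun c => code (t c)) -> definable_term t.
Proof.
move=> vt; apply: (@definable_iff _ (fun c : extend_real C =>
  code c.2 = code (t c.1))) => [c|]; first by split=> [/code_inj|->].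
apply: definable_eq; last exact: is_variable_real vt.
by exists 0%N.
Qed.

(** Weakening.  The formula for [t] lives in the context extended by the value
    of [t]; the new variable is inserted just below that value. *)
Lemma definable_term_real C (t : C -> R) :
  definable_term t -> @definable_term (extend_real C) (fun c => t c.1).
Proof.
pose k (d : extend_real (extend_real C)) : extend_real C := (d.1.1, d.2).
apply: (@definable_rename _ _ k (scons 0 (fun n => n.+2)))%N.
by move=> d; case.
Qed.

(** The order is read off its graph, a set of Kuratowski pairs, whose
    injectivity recovers the two reals. *)
Lemma definable_le C (t u : C -> R) :
  definable_term t -> definable_term u -> definable (fun c => t c <= u c).
Proof.
move=> dt du; apply: (definable_subst (P := fun c x => x <= u c) dt).
apply: (definable_subst (P := fun (c : extend_real C) x => c.2 <= x)
  (definable_term_real du)).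
set D := extend_real (extend_real C).
apply: (@definable_iff _ (fun c : D => exists v,
    is_pair (@mem M) v (code c.1.2) (code c.2) /\ mem v (order_graph ar))).
  move=> c; split=> [[v [pv /order_graphP [x [y [xy pv']]]]]|xy].
    by have [/code_inj -> /code_inj ->] := pair_inj pv pv'.
  have [v pv] := pair_ex (code c.1.2) (code c.2); exists v; split=> //.
  by apply/order_graphP; exists c.1.2, c.2.
apply: definable_ex_set; have := is_variable_set (order_variable D) => vo.
have v0 : is_variable (@env (extend_set D)) (fun c => c.2) by exists 0%N.
apply: definable_and; last exact: definable_mem.
by apply: definable_pair => //; [exists 2|exists 1%N].
Qed.

Lemma definable_lt C (t u : C -> R) :
  definable_term t -> definable_term u -> definable (fun c => t c < u c).
Proof.
move=> dt du; apply: (@definable_iff _ (fun c => ~ u c <= t c)) => [c|].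
  by rewrite ltNge; split=> /negP.
by apply: definable_not; apply: definable_le.
Qed.

(** Addition and multiplication in one proof.  Pairs are injective, so a triple
    in the graph determines its arguments and hence the value. *)
Lemma definable_term_operation (op : R -> R -> R) (G : M) :
  (forall v, mem v G <-> exists (x y : R) p,
     is_pair (@mem M) p (code x) (code y) /\
     is_pair (@mem M) v p (code (op x y))) ->
  (forall C, is_variable (@env C) (fun=> G)) ->
  forall C (t u : C -> R), definable_term t -> definable_term u ->
  definable_term (fun c => op (t c) (u c)).
Proof.
move=> GP vG C t u /definable_term_real dt /definable_term_real du.
apply: (definable_subst (P := fun (d : extend_real C) x => d.2 = op x (u d.1))
  dt).
apply: (definable_subst 
  (P := fun (d : extend_real (extend_real C)) x => d.1.2 = op d.2 x)
  (definable_term_real du)).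
set D := extend_real (extend_real (extend_real C)).
apply: (@definable_iff _ (fun c : D => exists p v,
    is_pair (@mem M) p (code c.1.2) (code c.2) /\
    (is_pair (@mem M) v p (code c.1.1.2) /\ mem v G))) => [c|].
  split=> [[p [v [pp [pv /GP [x [y [p' [pp' pv']]]]]]]]|e].
    have [ep /code_inj ->] := pair_inj pv pv'; subst p'.
    by have [/code_inj -> /code_inj ->] := pair_inj pp pp'.
  have [p pp] := pair_ex (code c.1.2) (code c.2).
  have [v pv] := pair_ex p (code c.1.1.2); exists p, v; do !split=> //.
  by apply/GP; exists c.1.2, c.2, p; rewrite -e.
do 2!apply: definable_ex_set.
apply: definable_and.
  by apply: definable_pair; [exists 1%N|exists 3|exists 2].
apply: definable_and.
  by apply: definable_pair; [exists 0%N|exists 1%N|exists 4].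
by apply: definable_mem; first exists 0%N.
Qed.

Lemma definable_term_add C (t u : C -> R) :
  definable_term t -> definable_term u ->
  definable_term (fun c => t c + u c).
Proof.
apply: definable_term_operation (sum_graphP ar) _ _ _ _ => D.
exact: sum_variable.
Qed.

Lemma definable_term_mul C (t u : C -> R) :
  definable_term t -> definable_term u ->
  definable_term (fun c => t c * u c).
Proof.
apply: definable_term_operation (product_graphP ar) _ _ _ _ => D.
exact: product_variable.
Qed.

Lemma definable_eq_real C (t u : C -> R) :
  definable_term t -> definable_term u -> definable (fun c => t c = u c).
Proof.
move=> dt du; apply: (@definable_iff _ (fun c => t c <= u c /\ u c <= t c)).
  by move=> c; split=> [[tu ut]|->] //; apply/eqP; rewrite eq_le tu ut.
by apply: definable_and; apply: definable_le.
Qed.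

Lemma definable_term_last C : @definable_term (extend_real C) (fun c => c.2).
Proof. by apply: definable_term_variable; exists 0%N. Qed.

(** The constants are defined by equations: 0 by x + x = x, and 1 by x * x = x
    with x positive. *)
Lemma definable_term0 C : @definable_term C (fun=> 0).
Proof.
apply: (@definable_iff _ (fun c : extend_real C => c.2 + c.2 = c.2)) => [c|].
  by split=> [|->]; [move/eqP; rewrite -subr_eq0 addrK => /eqP|rewrite addr0].
have d2 := @definable_term_last C.
by apply: definable_eq_real => //; apply: definable_term_add.
Qed.

Lemma definable_term1 C : @definable_term C (fun=> 1).
Proof.
apply: (@definable_iff _ (fun c : extend_real C =>
   c.2 * c.2 = c.2 /\ 0 < c.2)) => [c|].
  split=> [[e c0]|->]; last by rewrite mulr1 ltr01.
  by apply: (mulfI (lt0r_neq0 c0)); rewrite mulr1.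
have d2 := @definable_term_last C.
apply: definable_and; last by apply: definable_lt => //; apply: definable_term0.
by apply: definable_eq_real => //; apply: definable_term_mul.
Qed.

Lemma definable_term_opp C (t : C -> R) :
  definable_term t -> definable_term (fun c => - t c).
Proof.
move=> /definable_term_real dt.
apply: (@definable_iff _ (fun c : extend_real C => c.2 + t c.1 = 0)) => [c|].
  by split=> [/eqP|->]; [rewrite addr_eq0 => /eqP|rewrite addNr].
apply: definable_eq_real; last exact: definable_term0.
by apply: definable_term_add => //; apply: definable_term_last.
Qed.

Lemma definable_abs_lt C (t u : C -> R) :
  definable_term t -> definable_term u -> definable (fun c => `|t c| < u c).
Proof.
move=> dt du; apply: (@definable_iff _ (fun c => - u c < t c /\ t c < u c)).
  by move=> c; rewrite ltr_norml; split=> [[-> ->]|/andP].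
by apply: definable_and; apply: definable_lt => //; apply: definable_term_opp.
Qed.

Lemma definable_mem_real C (t : C -> R) (u : C -> M) :
  definable_term t -> is_variable (@env C) u ->
  definable (fun c => mem (code (t c)) (u c)).
Proof.
move=> dt /is_variable_real vu.
apply: (definable_subst (P := fun c x => mem (code x) (u c)) dt).
by apply: definable_mem; first exists 0%N.
Qed.

End Definability.

(** The environment of a concrete context computes, so the position of a variable
    is found by trial.  The comparison is syntactic because conversion between
    distinct variables would unfold the real numbers. *)
Ltac variable_from n :=
  first [ exists n; intros ?;
          cbv [env assignment extend_real extend_set parameters
               parameters1 scons];
          lazymatch goal with |- ?x = ?y => constr_eq x y; exact (erefl x) end
        | lazymatch n with 20%N => fail 1 "no such variable" | _ => idtac end;
          variable_from (S n) ].

Ltac variable := variable_from O.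

Ltac definability_step :=
  lazymatch goal with
  | |- definable_term (fun c => @Algebra.add _ (@?a c) (@?b c)) =>
      apply definable_term_add
  | |- definable_term (fun c => @Algebra.opp _ (@?a c)) =>
      apply definable_term_opp
  | |- definable_term (fun c => @GRing.mul _ (@?a c) (@?b c)) =>
      apply definable_term_mul
  | |- definable_term (fun c => @Algebra.zero _) => apply definable_term0
  | |- definable_term (fun c => @GRing.one _) => apply definable_term1
  | |- definable_term _ => apply definable_term_variable; variable
  | |- definable (fun c => mem (code (@?a c)) (@?b c)) =>
      apply definable_mem_real; [ | variable]
  | |- definable (fun c => mem (@?a c) (@?b c)) => apply definable_mem; variable
  | |- definable (fun c => code (@?a c) = @?b c) => apply definable_eq; variable
  | |- definable (fun c => is_true (Num.norm (@?a c) < @?b c)) =>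
      apply definable_abs_lt
  | |- definable (fun c => is_true (@?a c < @?b c)) => apply definable_lt
  | |- definable (fun c => is_true (@?a c <= @?b c)) => apply definable_le
  | |- definable (fun c => @?P c /\ @?Q c) => apply definable_and
  | |- definable (fun c => @?P c -> @?Q c) => apply definable_imp
  | |- definable (fun c => exists x, @?P c x) =>
      first [apply definable_ex_real | apply definable_ex_set]
  | |- definable (fun c => forall x, @?P c x) =>
      first [apply definable_all_real | apply definable_all_set]
  end.

Lemma definable_is_integer (M : istModel) (R : reals M) (ar : arithmetic R)
    (C : context ar) (t : C -> R) :
  definable_term t -> definable (fun c => is_integer (t c)).
Proof.
move=> dt; apply: (definable_subst (P := fun=> @is_integer M R) dt).
rewrite /is_integer; repeat (definability_step; cbv beta).
Qed.

Ltac definability :=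
  repeat (lazymatch goal with
    | |- definable (fun c => is_integer (@?t c)) => apply definable_is_integer
    | _ => definability_step
    end; cbv beta).

(** * The integers of the model *)

Section Integers.

Variables (M : istModel) (R : reals M) (ar : arithmetic R).
Implicit Types (e : nat -> M) (x y n : R).

Lemma set_comprehension e (P : M -> Prop) (a : M) :
  @definable _ _ ar (extend_set (parameters ar e)) (fun c => P c.2) ->
  exists b, forall v, mem v b <-> mem v a /\ P v.
Proof.
move=> [f If Hf]; have [b Hb] := separation (ist_zfc M) If
  (env (tt : parameters ar e)) a.
by exists b => v; rewrite Hb (Hf (tt, v)).
Qed.

Lemma real_comprehension e (P : R -> Prop) :
  @definable _ _ ar (extend_real (parameters ar e)) (fun c => P c.2) ->
  exists b, forall x, mem (code x) b <-> P x.
Proof.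
move=> [f If Hf]; have [b Hb] := separation (ist_zfc M) If
  (env (tt : parameters ar e)) (carrier ar).
exists b => x; rewrite Hb (Hf (tt, x)); split=> [[]|] //; split=> //.
by apply/carrierP; exists x.
Qed.

(** The definition of the integers is an induction principle for the sets of the
    model; comprehension turns it into one for definable predicates. *)
Lemma integer_ind e (P : R -> Prop) :
  @definable _ _ ar (extend_real (parameters ar e)) (fun c => P c.2) ->
  P 0 -> (forall y, P y -> P (y + 1) /\ P (y - 1)) ->
  forall x, is_integer x -> P x.
Proof.
move=> dP P0 PS x; have [b Hb] := real_comprehension dP => /(_ b).
rewrite !Hb; apply=> // y /Hb /PS [Py1 Py2].
by rewrite !Hb.
Qed.

Lemma is_integer0 : is_integer (0 : R).
Proof. by move=> S. Qed.

Lemma is_integer_step x :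
  is_integer x -> is_integer (x + 1) /\ is_integer (x - 1).
Proof.
by move=> ix; split=> S S0 SS; have [] := SS _ (ix S S0 SS).
Qed.

Lemma is_integer_add x y : is_integer x -> is_integer y -> is_integer (x + y).
Proof.
move=> ix; move: y.
apply: (@integer_ind (parameters1 ar (code x)) (fun y => is_integer (x + y))).
- definability.
- by rewrite addr0.
- by move=> y /is_integer_step; rewrite !addrA.
Qed.

Lemma is_integer_opp x : is_integer x -> is_integer (- x).
Proof.
move: x; apply: (@integer_ind (fun=> carrier ar) (fun y => is_integer (- y))).
- definability.
- by rewrite oppr0; apply: is_integer0.
- move=> y /is_integer_step [Iy1 Iy2].
  by rewrite opprD opprB [1 - y]addrC.
Qed.

Lemma is_integer_sub x y : is_integer x -> is_integer y -> is_integer (x - y).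
Proof. by move=> ix iy; apply: is_integer_add ix (is_integer_opp iy). Qed.

Lemma integer_set : exists Z : M, forall x, mem (code x) Z <-> is_integer x.
Proof.
apply: (@real_comprehension (fun=> carrier ar)); definability.
Qed.

(** The archimedean property inside the model, from completeness: if [s] were
    the least upper bound of the integers then [s - 1] would be an upper bound
    too. *)
Lemma integer_unbounded x : exists2 n, is_integer n & x < n.
Proof.
apply: NNPP => nE; have [Z HZ] := integer_set.
have [||s [ubs lubs]] := @real_complete M R Z.
- by exists 0; apply/HZ/is_integer0.
- exists x => n /HZ In; rewrite leNgt; apply/negP => xn.
  by apply: nE; exists n.
have: s <= s - 1.
  apply: lubs => n /HZ /is_integer_step [/HZ /ubs In _].
  by rewrite lerBrDr.
by rewrite lerBrDr -subr_ge0 opprD addrA subrr add0r ler0N1.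
Qed.

(** The integers below [x] have a least upper bound [s]; if all their successors
    were below [x] too, [s - 1] would bound them. *)
Lemma floor_ex x : exists n, [/\ is_integer n, n <= x & x < n + 1].
Proof.
have [|S HS] := @real_comprehension (parameters1 ar (code x))
  (fun n => is_integer n /\ n <= x); first by definability.
have [||s [ubs lubs]] := @real_complete M R S.
- have [n In xn] := integer_unbounded (- x).
  exists (- n); apply/HS; split; first exact: is_integer_opp.
  by rewrite lerNl ltW.
- by exists x => n /HS [].
apply: NNPP => nE; have: s <= s - 1.
  apply: lubs => n Sn; have [In nx] := (HS n).1 Sn.
  rewrite lerBrDr; apply: ubs; apply/HS; split.
    by have [] := is_integer_step In.
  by rewrite leNgt; apply/negP => xn; apply: nE; exists n.
by rewrite lerBrDr -subr_ge0 opprD addrA subrr add0r ler0N1.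
Qed.

End Integers.

(** * Simultaneous approximation modulo the integers *)

Section Approximation.

Variables (M : istModel) (R : reals M) (ar : arithmetic R).
Implicit Types (S G : M) (Q q x eta : R).

(** Closeness of the images of [Q] and [q] in the torus whose coordinates are
    indexed by the reals of [S]. *)
Definition near S eta Q q : Prop :=
  forall x : R, mem (code x) S ->
    exists P, is_integer P /\ `|(Q - q) * x - P| < eta.

(** Total boundedness of the image of the reals in that torus.  In place of
    finite nets, whose cardinality would have to be counted in the model, a net
    is a bounded part: in the applications [G] consists of integers.  The
    quantification over all sets [G] makes the property hereditary, with the net
    taken inside [G]; the induction in [totally_bounded_adjoin] relies on it. *)
Definition totally_bounded S : Prop :=
  forall eta : R, 0 < eta -> forall G : M, exists b : R,
    forall Q : R, mem (code Q) G ->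
      exists q : R, mem (code q) G /\ (`|q| < b /\ near S eta Q q).

Lemma totally_bounded_empty S : is_empty (@mem M) S -> totally_bounded S.
Proof.
move=> S0 eta _ G.
have [[q Gq]|G0] := classic (exists q : R, mem (code q) G).
  exists (`|q| + 1) => Q _; exists q; split=> //; split=> [|x /S0 //].
  by rewrite ltrDl ltr01.
by exists 0 => Q GQ; case: G0; exists Q.
Qed.

(** The interval of fractional parts of [Q * a] is cut into slices of length
    [eta].  The elements of [G] in one slice form a set, to which the hypothesis
    on [S] applies; two elements of the same slice are automatically close in the
    new coordinate.  The bounds for the successive slices are combined by
    induction on the number of slices. *)
Lemma totally_bounded_adjoin S T a :
  (forall x, mem (code x) T -> mem (code x) S \/ x = a) ->
  totally_bounded S -> totally_bounded T.
Proof.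
move=> TS tbS eta eta0 G.
pose slice t Q := exists P : R, is_integer P /\
  (0 <= Q * a - P /\ Q * a - P < t * eta).
pose claim t := exists b : R, forall Q : R, mem (code Q) G -> slice t Q ->
  exists q : R, mem (code q) G /\ (`|q| < b /\ near T eta Q q).
suff claim_int n : is_integer n -> claim n.
  have [n In n_eta] := integer_unbounded ar eta^-1.
  have [b Hb] := claim_int n In; exists b => Q GQ; apply: Hb => //.
  have [P [IP PQ QP]] := floor_ex ar (Q * a).
  exists P; split=> //; split; first by rewrite subr_ge0.
  have : 1 < n * eta by rewrite -ltr_pdivrMr ?mul1r.
  by apply: lt_trans; rewrite ltrBlDl.
apply: (@integer_ind _ _ ar (scons (code a) (scons (code eta) (scons T
  (parameters1 ar G))))).
- by rewrite /claim /slice /near; definability.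
(* No fractional part is in the empty union of slices. *)
- exists 0 => Q _ [P [_ [h1 h2]]].
  by move: (le_lt_trans h1 h2); rewrite mul0r ltxx.
move=> t [b Hb]; split; last first.
  (* The claim is monotone in [t], whence the step towards smaller integers. *)
  exists b => Q GQ [P [IP [h1 h2]]]; apply: Hb => //; exists P; do !split=> //.
  by apply: (lt_le_trans h2); rewrite ler_pM2r // gerBl ler01.
have [|G' HG'] := @real_comprehension _ _ ar (scons (code a)
  (scons (code eta) (scons (code t) (parameters1 ar G))))
  (fun Q => mem (code Q) G /\ exists P : R, is_integer P /\
     (t * eta <= Q * a - P /\ Q * a - P < (t + 1) * eta)).
  by definability.
have [b' Hb'] := tbS eta eta0 G'.
exists (Num.max b b') => Q GQ [P [IP [h1 h2]]].
have [lt_t|ge_t] := ltP (Q * a - P) (t * eta).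
  have [|q [Gq [qb nq]]] := Hb Q GQ; first by exists P.
  by exists q; split=> //; split; first by rewrite lt_max qb.
have [|q [/HG' [Gq [P' [IP' [h3 h4]]]] [qb nq]]] := Hb' Q.
  by apply/HG'; split=> //; exists P.
exists q; split=> //; split=> [|x /TS [/nq //|->]].
  by rewrite lt_max qb orbT.
exists (P - P'); split; first exact: (is_integer_sub ar).
by rewrite ltr_norml; apply/andP; split; lra.
Qed.

(** The family [K] in the definition of finiteness has to be a set: take the
    subsets of [z] that satisfy [P]. *)
Lemma finite_set_ind (e : nat -> M) (P : M -> Prop) z :
  @definable _ _ ar (extend_set (parameters ar e)) (fun c => P c.2) ->
  (forall s, is_empty (@mem M) s -> P s) ->
  (forall s t v, P s -> is_adjunction (@mem M) t s v -> P t) ->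
  finite (@mem M) z -> P z.
Proof.
move=> dP P0 PS; have [p Hp] := powerset (ist_zfc M) z.
have [K HK] := set_comprehension p dP => /(_ K) zK.
suff /HK [] : mem z K by [].
apply: zK => [s s0|s t v /HK [/Hp sz Ps] vz tsv]; apply/HK.
  by split; [apply/Hp => v /s0|apply: P0].
split; last exact: PS tsv.
by apply/Hp => w /tsv [/sz|->].
Qed.

Lemma finite_totally_bounded z : finite (@mem M) z -> totally_bounded z.
Proof.
apply: (@finite_set_ind (fun=> carrier ar)) => [||s t v tbs tsv].
- by rewrite /totally_bounded /near; definability.
- exact: totally_bounded_empty.
(* A finite set of the model may have elements that are not reals; they impose
   no condition. *)
have [[a va]|nv] := classic (exists a : R, v = code a).
  apply: (@totally_bounded_adjoin s _ a) => // x /tsv [|xv]; first by left.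
  by right; apply/(@code_inj _ R); rewrite xv.
apply: (@totally_bounded_adjoin s _ 0) => // x /tsv [|xv]; first by left.
by case: nv; exists x.
Qed.

Lemma finite_positive_bound z : finite (@mem M) z ->
  exists r : R, 0 < r /\ forall x : R, mem (code x) z -> 0 < x -> r <= x.
Proof.
apply: (@finite_set_ind (fun=> carrier ar) (fun z => exists r : R,
  0 < r /\ forall x : R, mem (code x) z -> 0 < x -> r <= x))
  => [|s s0|s t v [r [r0 Hr]] tsv].
- by definability.
- by exists 1; split; [exact: ltr01|move=> x /s0].
have [[a [va a0]]|nv] := classic (exists a : R, v = code a /\ 0 < a).
  exists (Num.min r a); rewrite lt_min r0 a0; split=> // x /tsv [sx|].
    by move=> x0; rewrite ge_min Hr.
  by rewrite va => /code_inj ->; rewrite ge_min lexx orbT.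
exists r; split=> // x /tsv [/Hr //|xv x0]; by case: nv; exists x.
Qed.

(** The conditions that a single real [y] imposes on the denominator [Q]. *)
Definition approximates (eps Q y : R) : Prop :=
  (0 < y -> eps * Q < y) /\
  exists P : R, is_integer P /\ `|y * Q - P| < (eps * Q) * (eps * Q).

(** The window for [Q] is [r / 2 < eps * Q < r].  Its lower end guarantees that
    the fixed error [r ^ 2 / 4] is at most [(eps * Q) ^ 2]; its upper end makes
    [eps * Q] smaller than the positive elements of [z].  [Q] is the difference
    between an integer [n + 1] in the window and an element [q] of the net close
    to it. *)
Lemma finite_approximation z : finite (@mem M) z ->
  exists h : R, 0 < h /\ forall eps : R, 0 < eps -> eps < h ->
    exists Q : R, (is_integer Q /\ 0 < Q) /\
      forall y : R, mem (code y) z -> approximates eps Q y.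
Proof.
move=> fz; have [r [r0 Hr]] := finite_positive_bound fz.
have [Z HZ] := integer_set ar.
have eta0 : 0 < r / 2 * (r / 2) by rewrite !mulr_gt0 ?invr_gt0.
have [b Hb] := finite_totally_bounded fz eta0 Z.
have b0 : 0 < b.
  have [|q [_ [qb _]]] := Hb 0; first exact/HZ/is_integer0.
  exact: le_lt_trans qb.
have c0 : 0 < 2 * b + 1 by lra.
exists (r / 2 / (2 * b + 1)); split; first by rewrite !divr_gt0.
move=> eps eps0; rewrite ltr_pdivlMr // => eps_h.
(* The margin [b] keeps [n + 1 - q] above the lower end of the window; the
   choice of [h] leaves room for [2 * b + 1] below the upper end. *)
have [n [In n1 n2]] := floor_ex ar (r / 2 / eps + b).
have [IN _] := is_integer_step In.
have [|q [/HZ Iq [qb nq]]] := Hb (n + 1); first exact/HZ.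
move: qb; rewrite ltr_norml => /andP [q1 q2].
have e1 : r / 2 < eps * (n + 1 - q).
  by rewrite [eps * _]mulrC -ltr_pdivrMr //; lra.
have e2 : eps * (n + 1 - q) < r.
  have : eps * (n + 1 - q) <= eps * (r / 2 / eps + (2 * b + 1)).
    by rewrite ler_pM2l //; lra.
  rewrite [X in _ <= X -> _]mulrDr [eps * (r / 2 / eps)]mulrC.
  by rewrite divfK ?gt_eqF //; lra.
exists (n + 1 - q); split.
  split; first exact: (is_integer_sub ar).
  by rewrite -(pmulr_rgt0 _ eps0); apply: lt_trans e1; lra.
move=> y yz; split=> [/(Hr _ yz)|]; first exact: lt_le_trans e2.
have [P [IP HP]] := nq y yz; exists P; split=> //.
by rewrite mulrC; apply: (lt_trans HP); apply: ltr_pM => //; lra.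
Qed.

End Approximation.

(** * Transfer and idealization *)

Section InternalSetTheory.

Variables (M : istModel) (R : reals M) (ar : arithmetic R).
Implicit Type e : nat -> M.

Lemma st_parameters e : (forall n, st (e n)) ->
  forall n, st (env (tt : parameters ar e) n).
Proof.
move=> se [|[|[|[|n]]]] /=; [exact: st_carrier|exact: st_sum_graph|
  exact: st_product_graph|exact: st_order_graph|exact: se].
Qed.

(** Transfer for an existential statement with standard parameters. *)
Lemma standard_witness e (P : R -> Prop) :
  (forall n, st (e n)) ->
  @definable _ _ ar (extend_real (parameters ar e)) (fun c => P c.2) ->
  (exists x, P x) -> exists x, standard x /\ P x.
Proof.
move=> se [f If Hf] [x Px]; apply: NNPP => nP.
have := @ist_transfer M (Neg (And (Mem 0 1) f)) If
  (env (tt : parameters ar e)) (fun n _ => st_parameters se n).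
move=> /(_ _ (code x)) /=; apply.
  move=> v sv [/carrierP [y yv]]; subst v => sat_y.
  by apply: nP; exists y; split=> //; apply/(Hf (tt, y)).
by split; [apply/carrierP; exists x|apply/(Hf (tt, x))].
Qed.

(** The direction of idealization that produces an ideal element, for an element
    sought among the reals.  The relation is conjoined with membership in the
    carrier, which a standard [y] then extracts: the carrier itself serves. *)
Lemma idealize e (P : R -> M -> Prop) :
  @definable _ _ ar (extend_real (extend_set (parameters ar e)))
    (fun c => P c.2 c.1.2) ->
  (forall z, st z -> finite (@mem M) z ->
     exists x, forall y, mem y z -> P x y) ->
  exists x, forall y, st y -> P x y.
Proof.
move=> [f If Hf] H.
have [I _] := @ist_idealization M (And (Mem 0 2) f) If
  (env (tt : parameters ar e)).
have [|v Hv] := I.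
  move=> z sz fz; have [x Hx] := H z sz fz; exists (code x) => y yz /=.
  by split; [apply/carrierP; exists x|apply/(Hf ((tt, y), x)); apply: Hx].
have [/carrierP [x /= xv] _] := Hv _ (st_carrier ar); subst v.
by exists x => y /Hv [_] /(Hf ((tt, y), x)).
Qed.

(** Transfer makes the threshold [h] of [finite_approximation] standard when [z]
    is, so [eps] is below it and each standard finite [z] has a common [Q]. *)
Lemma infinitesimal_approximation (eps : R) :
  0 < eps -> infinitesimal eps ->
  exists Q : R, [/\ is_integer Q, 0 < Q &
    forall y : R, standard y -> approximates eps Q y].
Proof.
move=> eps0 epsI.
have [|z sz fz|Q HQ] := @idealize (parameters1 ar (code eps)) (fun Q v =>
  (is_integer Q /\ 0 < Q) /\ forall y : R, code y = v -> approximates eps Q y).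
- by rewrite /approximates; definability.
- have [|||h [sh [h0 Hh]]] := @standard_witness (parameters1 ar z)
    (fun h => 0 < h /\ forall eps : R, 0 < eps -> eps < h ->
    exists Q : R, (is_integer Q /\ 0 < Q) /\
      forall y : R, mem (code y) z -> approximates eps Q y).
  + by case=> [|n] //=; apply: st_carrier.
  + by rewrite /approximates; definability.
  + exact: finite_approximation.
  have [|Q [IQ HQ]] := Hh eps eps0.
    by rewrite -[eps]gtr0_norm //; apply: epsI.
  by exists Q => v vz; split=> // y yv; apply: HQ; rewrite yv.
exists Q; have [[IQ Q0] _] := HQ _ (st_carrier ar); split=> // y sy.
by have [_] := HQ _ sy; apply.
Qed.

End InternalSetTheory.

Theorem theorem1p4 (M : istModel) (R : reals M) (eps : R)
    (eps_gt0 : 0 < eps) (eps_inf : infinitesimal eps) :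
  exists Q : R, [/\ is_integer Q, Q != 0 &
    forall x : R, standard x ->
      exists P phi : R,
        [/\ is_integer P, infinitesimal phi,
            x = P / Q + eps * phi & infinitesimal (eps * Q)]].
Proof.
have [ar] := arithmetic_ex R.
have [Q [IQ Q0 HQ]] := infinitesimal_approximation ar eps_gt0 eps_inf.
have eQ0 : 0 < eps * Q by rewrite mulr_gt0.
have eQ_inf : infinitesimal (eps * Q).
  by move=> r sr r0; rewrite gtr0_norm //; apply: (HQ r sr).1.
exists Q; split=> //; first by rewrite gt_eqF.
move=> x /HQ [_ [P [IP HP]]].
exists P, ((x * Q - P) / (eps * Q)); split=> //.
  move=> r sr r0; apply: lt_trans ((HQ r sr).1 r0).
  by rewrite normrM normfV [`|eps * Q|]gtr0_norm // ltr_pdivrMr.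
by field; rewrite !gt_eqF.
Qed.
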